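(* There exist a Coxeter group $W$ with simple generators $S$, a (symmetrizable generalized) Cartan matrix $A$ for $W$, an orientation $\Omega$ of the Coxeter diagram $\Gamma$ of $W$, and an element $w\in W$ with reduced word $a_1a_2\cdots a_k$ such that, writing $t_1=a_1$, $t_2=a_1a_2a_1$, $\ldots$, $t_k=a_1a_2\cdots a_k\cdots a_2a_1$: (1) $w$ is not $\Omega$-sortable; but (2) for $i<j$, we have $\omega_\Omega(\beta_{t_i},\beta_{t_j})\ge 0$, with strict inequality holding unless $t_i$ and $t_j$ commute; and (3) whenever $r$, $s$ and $t$ are reflections in $W$, with $\beta_s$ in the positive span of $\beta_r$ and $\beta_t$ and $\omega_\Omega(\beta_r,\beta_t)\ge 0$, then $\mathrm{inv}(w)\cap\{r,s,t\}$ is either $\emptyset$, $\{r\}$, $\{r,s\}$, $\{r,s,t\}$ or $\{t\}$.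
   Context: $W$ is a Coxeter group with finite set $S$ of simple generators; $m(s,t)$ is the order of $st$ (possibly $\infty$), $\ell$ is the length function and $e$ the identity. The (right) weak order on $W$ sets $u\le w$ if and only if $\ell(u)+\ell(u^{-1}w)=\ell(w)$. The Coxeter diagram $\Gamma$ is the graph with vertex set $S$ in which distinct $s,t$ are joined by an edge if and only if they do not commute. An orientation $\Omega$ gives each edge of $\Gamma$ one direction (directed cycles are allowed). A subset $J\subseteq S$ is $\Omega$-acyclic if the induced subgraph of $\Gamma$ on $J$, oriented by $\Omega$, has no directed cycle. For $\Omega$-acyclic $J$, $c(\Omega,J)=s_1s_2\cdots s_k$, where $s_1,\ldots,s_k$ is any ordering of $J$ such that $i<j$ whenever there is an edge oriented $s_j\to s_i$ (the product does not depend on the ordering; $c(\Omega,\emptyset)=e$). $J(w,\Omega)$ denotes the unique maximal (under inclusion) element among the $\Omega$-acyclic subsets $J'\subseteq S$ with $w\ge c(\Omega,J')$ (it is a fact that there is a unique maximal one, which therefore contains all the others). Given $w\in W$, set $w_1=w$ and, inductively, $J_i=J(w_i,\Omega)$, $w_{i+1}=c(\Omega,J_i)^{-1}w_i$. The element $w$ is $\Omega$-sortable if $J_1\supseteq J_2\supseteq J_3\supseteq\cdots$. Reflections are the conjugates of elements of $S$; $\mathrm{inv}(w)$ is the set of reflections $t$ with $\ell(tw)<\ell(w)$. A symmetrizable generalized Cartan matrix for $W$ is a real $S\times S$ matrix $A$ with $A_{ss}=2$; $A_{ss'}\le 0$ for $s\ne s'$, with $A_{ss'}A_{s's}=4\cos^2(\pi/m(s,s'))$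 if $m(s,s')<\infty$ and $A_{ss'}A_{s's}\ge 4$ if $m(s,s')=\infty$; $A_{ss'}=0$ if and only if $A_{s's}=0$; and such that there is a positive function $\delta$ on $S$ with $\delta(s)A_{ss'}=\delta(s')A_{s's}$ for all $s,s'$ and $\delta(s)=\delta(s')$ whenever $s,s'$ are conjugate in $W$. $V$ is the real vector space with basis $\{\alpha_s:s\in S\}$ (the simple roots), with $W$ acting by $s(\alpha_{s'})=\alpha_{s'}-A_{ss'}\alpha_s$. Roots are the vectors $w\alpha_s$; positive roots are those that are nonnegative combinations of simple roots. There is a bijection $t\mapsto\beta_t$ from reflections to positive roots such that $\beta_s=\alpha_s$ for $s\in S$ and $w\alpha_s=\pm\beta_{wsw^{-1}}$. The simple co-roots are $\alpha_s^\vee=\delta(s)^{-1}\alpha_s$. The skew-symmetric bilinear form $\omega_\Omega$ on $V$ is defined by $\omega_\Omega(\alpha_r^\vee,\alpha_s)=A_{rs}$ if the edge is oriented $r\to s$ in $\Omega$, $\omega_\Omega(\alpha_r^\vee,\alpha_s)=-A_{rs}$ if it is oriented $s\to r$, and $\omega_\Omega(\alpha_r^\vee,\alpha_s)=0$ if there is no edge between $r$ and $s$ (in particular if $r=s$). *)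

(* Defs.v *)
From HB Require Import structures.
From mathcomp Require Import all_boot all_order all_algebra.
From mathcomp Require Import all_classical all_reals all_analysis.

Set Implicit Arguments.
Unset Strict Implicit.
Unset Printing Implicit Defensive.

Import Order.TTheory GRing.Theory Num.Theory.

Local Open Scope classical_set_scope.
Local Open Scope group_scope.

(** * Coxeter systems *)

Definition word_prod (W : groupType) (S : finType) (gen : S -> W)
  (u : seq S) : W := \prod_(s <- u) gen s.

(* The congruence on words generated by (st)^(m s t) ~ empty word; it contains
   ss ~ empty word because m s s = 1 in a Coxeter system.  The value m s t = 0
   encodes infinite order and contributes only the trivial relator. *)
Inductive coxeter_equiv (S : finType) (m : S -> S -> nat) :
    seq S -> seq S -> Prop :=
| CoxRelator (u v : seq S) (s t : S) :
    coxeter_equiv m (u ++ flatten (nseq (m s t) [:: s; t]) ++ v) (u ++ v)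
| CoxRefl (u : seq S) : coxeter_equiv m u u
| CoxSym (u v : seq S) : coxeter_equiv m u v -> coxeter_equiv m v u
| CoxTrans (u v x : seq S) :
    coxeter_equiv m u v -> coxeter_equiv m v x -> coxeter_equiv m u x.

(* [cox_order] says that m s t is the order of st: since 0 %| n means n = 0,
   the value 0 stands for infinite order.  [cox_generated] and [cox_presented]
   say that W is presented by the relations (st)^(m s t) = 1. *)
Record coxeter_system (W : groupType) (S : finType) (gen : S -> W)
    (m : S -> S -> nat) : Prop := CoxeterSystem {
  cox_inj : injective gen;
  cox_involution : forall s, gen s * gen s = 1;
  cox_order : forall s t n, (gen s * gen t) ^+ n = 1 <-> (m s t %| n)%N;
  cox_generated : forall w, exists u, word_prod gen u = w;
  cox_presented :
    forall u v, word_prod gen u = word_prod gen v -> coxeter_equiv m u v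
}.

Definition reduced_word (W : groupType) (S : finType) (gen : S -> W)
    (w : W) (u : seq S) : Prop :=
  word_prod gen u = w /\
  forall v, word_prod gen v = w -> (size u <= size v)%N.

Definition len (W : groupType) (S : finType) (gen : S -> W) (w : W) : nat :=
  xget 0%N [set n | exists2 u, reduced_word gen w u & size u = n].

Definition weak_le (W : groupType) (S : finType) (gen : S -> W)
    (u w : W) : Prop :=
  (len gen u + len gen (u^-1 * w)%g)%N = len gen w.

Definition reflection (W : groupType) (S : finType) (gen : S -> W) : set W :=
  [set t | exists w s, t = w * gen s * w^-1].

Definition inversions (W : groupType) (S : finType) (gen : S -> W)
    (w : W) : set W :=
  [set t | reflection gen t /\ (len gen (t * w)%g < len gen w)%N].

(** * Orientations and sortable elements *)

Definition diagram (W : groupType) (S : finType) (gen : S -> W) : rel S :=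
  fun s t => (s != t) && (gen s * gen t != gen t * gen s).

(* [Om s t] means that the edge between s and t is oriented s -> t. *)
Definition orientation (W : groupType) (S : finType) (gen : S -> W)
    (Om : rel S) : Prop :=
  (forall s t, diagram gen s t = Om s t || Om t s) /\
  (forall s t, ~~ (Om s t && Om t s)).

Definition acyclic (S : finType) (Om : rel S) (J : {set S}) : Prop :=
  forall p : seq S, p != [::] -> {subset p <= J} -> ~~ cycle Om p.

Definition ordering_of (S : finType) (Om : rel S) (J : {set S})
    (u : seq S) : Prop :=
  [/\ uniq u, u =i J &
      {in J &, forall s t, Om t s -> (index s u < index t u)%N}].

(* For acyclic J an admissible ordering exists and the product does not depend
   on the one chosen by [xget]; the value for other J is never used. *)
Definition cox_elt (W : groupType) (S : finType) (gen : S -> W) (Om : rel S)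
    (J : {set S}) : W :=
  word_prod gen (xget [::] [set u | ordering_of Om J u]).

Definition candidate (W : groupType) (S : finType) (gen : S -> W)
    (Om : rel S) (w : W) (J : {set S}) : Prop :=
  acyclic Om J /\ weak_le gen (cox_elt gen Om J) w.

(* The maximal candidate is unique in a Coxeter system. *)
Definition Jmax (W : groupType) (S : finType) (gen : S -> W) (Om : rel S)
    (w : W) : {set S} :=
  xget finset.set0
    [set J | maxset [pred K | `[< candidate gen Om w K >]] J].

(* [sort_seq gen Om w i] is w_{i+1}: the sequence is indexed from 0. *)
Fixpoint sort_seq (W : groupType) (S : finType) (gen : S -> W) (Om : rel S)
    (w : W) (i : nat) : W :=
  if i is i'.+1 then
    let w' := sort_seq gen Om w i' in
    (cox_elt gen Om (Jmax gen Om w'))^-1 * w'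
  else w.

Definition sortable (W : groupType) (S : finType) (gen : S -> W) (Om : rel S)
    (w : W) : Prop :=
  forall i, Jmax gen Om (sort_seq gen Om w i.+1)
              \subset Jmax gen Om (sort_seq gen Om w i).

(** * Cartan matrices and roots *)

Local Open Scope ring_scope.

Record cartan_matrix (R : realType) (W : groupType) (S : finType)
    (gen : S -> W) (m : S -> S -> nat) (A : S -> S -> R) (delta : S -> R) :
    Prop := CartanMatrix {
  cartan_diag : forall s, A s s = 2;
  cartan_le0 : forall s t, s != t -> A s t <= 0;
  cartan_fin : forall s t, s != t -> m s t != 0%N ->
    A s t * A t s = 4 * cos (pi / (m s t)%:R) ^+ 2;
  cartan_inf : forall s t, s != t -> m s t = 0%N -> 4 <= A s t * A t s;
  cartan_eq0 : forall s t, A s t = 0 <-> A t s = 0;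
  cartan_delta_gt0 : forall s, 0 < delta s;
  cartan_symm : forall s t, delta s * A s t = delta t * A t s;
  cartan_delta_conj : forall s t,
    (exists w : W, gen t = (w * gen s * w^-1)%g) -> delta s = delta t
}.

(* V is the space of coordinate vectors in the basis of simple roots. *)
Definition simple_root (R : realType) (S : finType) (s : S) :
    {ffun S -> R^o} := [ffun t => (t == s)%:R].

(* The linear action of W on V; it is determined by [refl_rep_gen]. *)
Record reflection_rep (R : realType) (W : groupType) (S : finType)
    (gen : S -> W) (A : S -> S -> R)
    (act : W -> {linear {ffun S -> R^o} -> {ffun S -> R^o}}) : Prop :=
  ReflectionRep {
  refl_rep1 : forall v, act 1%g v = v;
  refl_repM : forall w x v, act (w * x)%g v = act w (act x v);
  refl_rep_gen : forall s t,
    act (gen s) (simple_root R t) = simple_root R t - A s t *: simple_root R s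
}.

Definition is_root (R : realType) (W : groupType) (S : finType)
    (act : W -> {linear {ffun S -> R^o} -> {ffun S -> R^o}}) :
    set {ffun S -> R^o} :=
  [set v | exists w s, v = act w (simple_root R s)].

Definition positive_root (R : realType) (W : groupType) (S : finType)
    (act : W -> {linear {ffun S -> R^o} -> {ffun S -> R^o}}) :
    set {ffun S -> R^o} :=
  [set v | is_root act v /\ forall s, 0 <= (v s : R)].

(* These conditions determine beta on reflections: beta of w s w^-1 is the
   positive one of the two vectors w alpha_s and - w alpha_s. *)
Record root_labelling (R : realType) (W : groupType) (S : finType)
    (gen : S -> W)
    (act : W -> {linear {ffun S -> R^o} -> {ffun S -> R^o}})
    (beta : W -> {ffun S -> R^o}) : Prop := RootLabelling {
  labelling_bij : set_bij (reflection gen) (positive_root act) beta;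
  labelling_simple : forall s, beta (gen s) = simple_root R s;
  labelling_act : forall w s,
    act w (simple_root R s) = beta (w * gen s * w^-1)%g \/
    act w (simple_root R s) = - beta (w * gen s * w^-1)%g
}.

Definition simple_coroot (R : realType) (S : finType) (delta : S -> R)
    (s : S) : {ffun S -> R^o} := (delta s)^-1 *: simple_root R s.

Definition omega_coef (R : realType) (S : finType) (A : S -> S -> R)
    (Om : rel S) (r s : S) : R :=
  if Om r s then A r s else if Om s r then - A r s else 0.

(* The bilinear form with omega (alpha_r^vee, alpha_s) = omega_coef r s: the
   coordinates of x in the basis of simple co-roots are delta r * x r. *)
Definition omega (R : realType) (S : finType) (A : S -> S -> R)
    (delta : S -> R) (Om : rel S) (x y : {ffun S -> R^o}) : R :=
  \sum_(r : S) \sum_(s : S) (delta r * x r) * y s * omega_coef A Om r s.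

Lemma omega_coroot_root (R : realType) (S : finType) (A : S -> S -> R)
    (delta : S -> R) (Om : rel S) (r s : S) :
  0 < delta r ->
  omega A delta Om (simple_coroot delta r) (simple_root R s)
    = omega_coef A Om r s.
Proof.
move=> d0; rewrite /omega (bigD1 r) //= (bigD1 s) //= !big1 ?addr0.
- rewrite /simple_coroot !ffunE !eqxx mulr1.
  by rewrite /GRing.scale /= mulr1 divff ?gt_eqF// mul1r.
- move=> i ir; rewrite big1// => j _.
  by rewrite /simple_coroot !ffunE (negbTE ir) scaler0 mulr0 !mul0r.
- by move=> j js; rewrite !ffunE (negbTE js) mulr0 mul0r.
Qed.

(* b is in the nonnegative span of x and y. *)
Definition in_positive_span (R : realType) (S : finType)
    (b x y : {ffun S -> R^o}) : Prop :=
  exists c d : R, [/\ 0 <= c, 0 <= d & b = c *: x + d *: y].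

(* For a reduced word a_1 ... a_k, this is t_{i+1} = a_1 ... a_{i+1} ... a_1
   (indexing from 0, meaningful for i < k). *)
Definition word_reflection (W : groupType) (S : finType) (gen : S -> W)
    (a : seq S) (i : nat) : W :=
  word_prod gen (take i.+1 a ++ rev (take i a)).

(* Main.v *)
Require Import Defs.
From HB Require Import structures.
From mathcomp Require Import all_boot all_order all_algebra.
From mathcomp Require Import all_classical all_reals all_analysis.
From mathcomp Require Import ring lra.

(** Take three generators p, q, r (here 0, 1, 2) with no braid relations, the
cyclic orientation q -> p, r -> q, p -> r, and w = pqr.  The subset {p, q, r}
is a directed cycle, hence not acyclic, so the greedy factorization of w
starts with {p, q} and continues with {r}, which is not contained in {p, q}:
w is not sortable.

The two alignment conditions can nevertheless be arranged by choosing the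
Cartan matrix.  Take it symmetric, with off-diagonal entries -a, -b, -e for the
pairs pq, qr, pr.  The inversions of w have the roots
  alpha_p,  alpha_q + a alpha_p,  alpha_r + b alpha_q + (a b + e) alpha_p,
and omega takes the values a, a b - e and b - 2 a e on the pairs (first,
second), (first, third) and (second, third).  With a = e = 2 and b = 9 all
three are positive, which is the condition on pairs ([omega3_root]).

For the condition on triples r, s, t, inversion sets are biconvex
([inversions_biconvex]), so the only pattern to exclude is that s and t, but
not r, are inversions, with s <> t ([triple_meet]).  Write
beta_s = c beta_r + d beta_t.  If s precedes t in the inversion order, beta_t
has a simple root in its support that beta_s lacks, so d = 0 and s = r; if t
precedes s, then omega(beta_s, beta_t) = c omega(beta_r, beta_t) >= 0
contradicts omega(beta_t, beta_s) > 0 ([aligned3]).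

The group is realized by its normal forms, the words without two equal
adjacent letters.  The root system is controlled by one observation
([root_dominant]): if u s is such a word, then u alpha_s is nonnegative and its
strictly largest coordinate is at the first letter of u s.  Positivity of
roots, and the fact that a root determines its reflection
([root_word_inj]), follow from it, without an invariant form. *)

Set Implicit Arguments.
Unset Strict Implicit.
Unset Printing Implicit Defensive.

Import Order.TTheory GRing.Theory Num.Theory.

Local Open Scope classical_set_scope.
Local Open Scope ring_scope.

(** * Reduced words for involutive generators without braid relations *)

Definition reduced (S : eqType) (x : seq S) : bool :=
  sorted (fun s t => s != t) x.

(** Left multiplication by a generator, on normal forms. *)
Definition push (S : eqType) (s : S) (x : seq S) : seq S :=
  if x is t :: x' then if s == t then x' else s :: x else [:: s].

Definition wmul (S : eqType) (x y : seq S) : seq S := foldr (@push S) y x.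

Lemma reduced_tail (S : eqType) (s : S) x : reduced (s :: x) -> reduced x.
Proof. exact: path_sorted. Qed.

Lemma reduced_cat (S : eqType) (x y : seq S) s :
  reduced (x ++ s :: y) = reduced (rcons x s) && reduced (s :: y).
Proof. exact: sorted_cat_cons. Qed.

Lemma reduced_rev (S : eqType) (x : seq S) : reduced (rev x) = reduced x.
Proof.
by rewrite /reduced rev_sorted; apply: eq_sorted => s t; rewrite /= eq_sym.
Qed.

Lemma reduced_cons (S : eqType) (s : S) x :
  reduced (s :: x) = (ohead x != Some s) && reduced x.
Proof. by case: x => //= t x; rewrite eq_sym. Qed.

Lemma reduced_rcons (S : eqType) (x : seq S) s :
  reduced (rcons x s) = (ohead (rev x) != Some s) && reduced x.
Proof. by rewrite -reduced_rev rev_rcons reduced_cons reduced_rev. Qed.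

Lemma uniq_reduced (S : eqType) (u : seq S) : uniq u -> reduced u.
Proof. by rewrite uniq_pairwise => /pairwise_sorted. Qed.

Lemma push_reduced (S : eqType) (s : S) x : reduced x -> reduced (push s x).
Proof.
case: x => //= t x; case: eqP => [_ /path_sorted//|/eqP st xr /=].
by rewrite st.
Qed.

Lemma wmul_reduced (S : eqType) (x y : seq S) : reduced y -> reduced (wmul x y).
Proof. by move=> yr; elim: x => //= s x; exact: push_reduced. Qed.

Lemma pushK (S : eqType) (s : S) x : reduced x -> push s (push s x) = x.
Proof.
case: x => [|t x] /=; first by rewrite eqxx.
case: eqP => [<-|_ _]; last by rewrite /= eqxx.
by case: x => //= u x /andP[/negbTE-> _].
Qed.

Lemma push_cons (S : eqType) (s : S) x : reduced (s :: x) -> push s x = s :: x.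
Proof. by case: x => //= t x /andP[/negbTE-> _]. Qed.

Lemma reduced_push_head (S : eqType) (s : S) x :
  reduced x -> ohead x = Some s -> reduced (s :: push s x).
Proof. by case: x => //= t x tx [<-]; rewrite eqxx. Qed.

Lemma size_push_le (S : eqType) (s : S) x : (size (push s x) <= (size x).+1)%N.
Proof. by case: x => //= t x; case: eqP => _ //=; rewrite ltnW. Qed.

Lemma size_wmul_le (S : eqType) (x y : seq S) :
  (size (wmul x y) <= size x + size y)%N.
Proof.
elim: x => //= s x IH; apply: (leq_trans (size_push_le _ _)).
by rewrite addSn ltnS.
Qed.

Lemma wmul_cat (S : eqType) (x y : seq S) :
  reduced (x ++ y) -> wmul x y = x ++ y.
Proof.
by elim: x => //= s x IH xyr; rewrite IH ?(reduced_tail xyr)// push_cons.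
Qed.

Lemma wmul_push (S : eqType) (s : S) x z : reduced z ->
  wmul (push s x) z = push s (wmul x z).
Proof.
case: x => //= t x zr; case: eqP => // ->.
by rewrite pushK// wmul_reduced.
Qed.

Lemma wmulA (S : eqType) (x y z : seq S) : reduced z ->
  wmul x (wmul y z) = wmul (wmul x y) z.
Proof. by move=> zr; elim: x => //= s x ->; rewrite wmul_push. Qed.

Lemma wmulVw (S : eqType) (x y : seq S) : reduced y ->
  wmul (rev x) (wmul x y) = y.
Proof.
move=> yr; elim: x => //= s x IH.
by rewrite rev_cons -cats1 /wmul foldr_cat /= pushK ?wmul_reduced.
Qed.

Lemma wmul_rev (S : eqType) (x : seq S) : reduced x -> wmul (rev x) x = [::].
Proof.
move=> xr; have := @wmulVw _ x [::] isT.
by rewrite (@wmul_cat _ x) cats0; exact.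
Qed.

(** * The universal Coxeter group *)

(** The free product of copies of Z/2 indexed by S; the normal form of an
element is its unique reduced word. *)
Definition ucox (S : finType) : Type := {x : seq S | reduced x}.

HB.instance Definition _ (S : finType) := Choice.on (ucox S).

Definition uone (S : finType) : ucox S := exist _ [::] isT.

Definition umul (S : finType) (x y : ucox S) : ucox S :=
  exist _ (wmul (val x) (val y)) (wmul_reduced _ (valP y)).

Definition uinv (S : finType) (x : ucox S) : ucox S :=
  exist _ (rev (val x)) (etrans (reduced_rev (val x)) (valP x)).

Lemma umulA (S : finType) : associative (@umul S).
Proof. by move=> x y z; apply: val_inj; rewrite /= wmulA// (valP z). Qed.

Lemma umul1g (S : finType) : left_id (@uone S) (@umul S).
Proof. by move=> x; apply: val_inj. Qed.

Lemma umulg1 (S : finType) : right_id (@uone S) (@umul S).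
Proof.
by move=> x; apply: val_inj; rewrite /= wmul_cat cats0// (valP x).
Qed.

Lemma umulVg (S : finType) : left_inverse (@uone S) (@uinv S) (@umul S).
Proof. by move=> x; apply: val_inj; rewrite /= wmul_rev ?(valP x). Qed.

Lemma umulgV (S : finType) : right_inverse (@uone S) (@uinv S) (@umul S).
Proof.
move=> x; apply: val_inj; rewrite /= -[X in wmul X _]revK wmul_rev//.
by rewrite reduced_rev (valP x).
Qed.

HB.instance Definition _ (S : finType) :=
  isGroup.Build (ucox S) (@umulA S) (@umul1g S) (@umulg1 S) (@umulVg S)
    (@umulgV S).

Definition ugen (S : finType) (s : S) : ucox S := exist _ [:: s] isT.

Lemma val_ucoxM (S : finType) (x y : ucox S) :
  val (x * y)%g = wmul (val x) (val y).
Proof. by []. Qed.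

Lemma val_ucoxV (S : finType) (x : ucox S) : val (x^-1)%g = rev (val x).
Proof. by []. Qed.

Lemma val_word_prod (S : finType) (u : seq S) :
  val (word_prod (@ugen S) u) = wmul u [::].
Proof.
rewrite /word_prod; elim: u => [|s u IH]; first by rewrite big_nil.
by rewrite big_cons val_ucoxM IH.
Qed.

Lemma val_word_prod_reduced (S : finType) (u : seq S) : reduced u ->
  val (word_prod (@ugen S) u) = u.
Proof. by move=> ur; rewrite val_word_prod wmul_cat cats0. Qed.

Lemma word_prod_val (S : finType) (w : ucox S) :
  word_prod (@ugen S) (val w) = w.
Proof. by apply: val_inj; rewrite val_word_prod_reduced// (valP w). Qed.

Lemma ugenK (S : finType) (s : S) : (ugen s * ugen s = 1)%g.
Proof. by apply: val_inj; rewrite /= eqxx. Qed.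

Lemma ugenV (S : finType) (s : S) : ((ugen s)^-1 = ugen s)%g.
Proof. exact: val_inj. Qed.

(** The order of s t is 1 if s = t, and infinite (encoded by 0) otherwise. *)
Definition uord (S : finType) (s t : S) : nat := (s == t).

Lemma coxeter_equiv_cons (S : finType) (m : S -> S -> nat) s (u v : seq S) :
  coxeter_equiv m u v -> coxeter_equiv m (s :: u) (s :: v).
Proof.
elim=> {u v} [u v x y|u|u v _ IH|u v x _ IHuv _ IHvx].
- by have := CoxRelator m (s :: u) v x y.
- exact: CoxRefl.
- exact: CoxSym.
- exact: CoxTrans IHuv IHvx.
Qed.

(** Every word rewrites to its normal form by deleting factors s s, so words
with equal products are equivalent. *)
Lemma coxeter_equiv_wmul (S : finType) (u : seq S) :
  coxeter_equiv (@uord S) u (wmul u [::]).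
Proof.
elim: u => [|s u IH]; first exact: CoxRefl.
apply: CoxTrans (coxeter_equiv_cons s IH) _ => /=.
case: (wmul u [::]) => [|t x] /=; first exact: CoxRefl.
case: eqP => [<-|_]; last exact: CoxRefl.
have := CoxRelator (@uord S) [::] x s s.
by rewrite /uord eqxx.
Qed.

Lemma val_expg_ugen (S : finType) (s t : S) n : s != t ->
  val ((ugen s * ugen t) ^+ n)%g = flatten (nseq n [:: s; t]).
Proof.
move=> st; elim: n => // n IH; rewrite expgS val_ucoxM IH val_ucoxM.
rewrite -wmulA /= ?(negbTE st); last first.
  by rewrite -IH; exact: valP ((ugen s * ugen t) ^+ n)%g.
case: n {IH} => [|n] /=; first by rewrite (negbTE st).
by rewrite (eq_sym t) (negbTE st) /= (negbTE st).
Qed.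

Lemma ucox_system (S : finType) : coxeter_system (@ugen S) (@uord S).
Proof.
split.
- by move=> s t /(congr1 val) [].
- exact: ugenK.
- move=> s t n; rewrite /uord; case: eqP => [<-|/eqP st].
    by rewrite ugenK expg1n dvd1n.
  rewrite dvd0n; split=> [/(congr1 val)|/eqP->]; last exact: expg0.
  by rewrite val_expg_ugen//; case: n.
- by move=> w; exists (val w); exact: word_prod_val.
- move=> u v /(congr1 val); rewrite !val_word_prod => uv.
  apply: CoxTrans (coxeter_equiv_wmul u) _; rewrite uv.
  exact/CoxSym/coxeter_equiv_wmul.
Qed.

Lemma reduced_word_val (S : finType) (w : ucox S) :
  reduced_word (@ugen S) w (val w).
Proof.
split=> [|v <-]; first exact: word_prod_val.
by rewrite val_word_prod (leq_trans (size_wmul_le _ _))// addn0.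
Qed.

Lemma len_ucox (S : finType) (w : ucox S) : len (@ugen S) w = size (val w).
Proof.
apply: xget_unique; first by exists (val w) => //; exact: reduced_word_val.
move=> _ [u [uw umin] <-]; apply/eqP; rewrite eqn_leq.
have [vw vmin] := reduced_word_val w.
by rewrite umin// vmin.
Qed.

(** Weak order is the prefix order: lengths add in u * (u^-1 * w) exactly when
no cancellation occurs, and then normal forms are concatenated. *)
Lemma weak_le_ucox (S : finType) (u w : ucox S) :
  weak_le (@ugen S) u w <-> prefix (val u) (val w).
Proof.
rewrite /weak_le !len_ucox; split=> [uw|/prefixP[z wz]].
  suff -> : val w = val u ++ val (u^-1 * w)%g by exact: prefix_prefix.
  have : val w = wmul (val u) (val (u^-1 * w)%g) by rewrite -val_ucoxM mulVKg.
  move=> wE; rewrite wE; move: uw; rewrite wE {wE}.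
  move: (val u) (val (u^-1 * w)%g) => x y.
  elim: x => //= s x IH; rewrite addSn => xy.
  have xyE : wmul x y = x ++ y.
    apply: IH; apply/eqP; rewrite eqn_leq size_wmul_le andbT.
    by rewrite -ltnS xy size_push_le.
  move: xy; rewrite xyE; case: (x ++ y) (size_cat x y) => [|t z] /= <- //.
  case: eqP => // _ /= /eqP.
  by rewrite -[X in _ == X]add0n -[X in X == _]add2n eqn_add2r.
have -> : (u^-1 * w)%g = word_prod (@ugen S) z.
  apply: (mulgI u); rewrite mulVKg; apply: val_inj.
  rewrite val_ucoxM val_word_prod_reduced; last first.
    by have := valP w; rewrite wz => /cat_sorted2[].
  by rewrite wmul_cat// -wz (valP w).
rewrite val_word_prod_reduced ?wz ?size_cat//.
by have := valP w; rewrite wz => /cat_sorted2[].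
Qed.

(** * Descents, reflections and inversions *)

Lemma size_ugenM (S : finType) (s : S) (h : ucox S) :
  (size (val (ugen s * h)%g) < size (val h))%N = (ohead (val h) == Some s).
Proof.
rewrite val_ucoxM /=; case: (val h) => //= t x.
rewrite -[RHS]/(t == s) eq_sym; case: eqP => _ /=; first by rewrite ltnS leqnn.
by rewrite ltnNge ltnW.
Qed.

(** Cancelling g against w leaves a word starting with s exactly when w starts
with the word of g followed by s. *)
Lemma descent_prefix (S : finType) (g w : ucox S) s :
  reduced (rcons (val g) s) ->
  (ohead (val (g^-1 * w)%g) == Some s) = prefix (rcons (val g) s) (val w).
Proof.
move=> gs; apply/eqP/prefixP => [|[z wz]].
  have : val w = wmul (val g) (val (g^-1 * w)%g) by rewrite -val_ucoxM mulVKg.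
  have := valP (g^-1 * w)%g; case: (val (g^-1 * w)%g) => //= t z tz wE [ts].
  exists z; rewrite wE ts wmul_cat ?cat_rcons// reduced_cat gs.
  by rewrite -ts.
have szr : reduced (s :: z).
  by have := valP w; rewrite /= wz cat_rcons reduced_cat => /andP[].
rewrite val_ucoxM wz cat_rcons -wmul_cat ?wmulVw// reduced_cat gs.
exact: szr.
Qed.

(** Every conjugate of a generator has a palindromic normal form, because
g s g^-1 = (g s) s (g s)^-1: of g and g s, the shorter one can be used. *)
Lemma reflection_reduced_rep (S : finType) (g : ucox S) s :
  exists h : ucox S,
  [/\ reduced (rcons (val h) s), (g * ugen s * g^-1 = h * ugen s * h^-1)%g &
      g = h \/ g = (h * ugen s)%g].
Proof.
have [gs|/negP gs] := boolP (reduced (rcons (val g) s)).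
  by exists g; split => //; left.
exists (g * ugen s)%g; split; last by right; rewrite -mulgA ugenK mulg1.
- move: gs; rewrite reduced_rcons (valP g) andbT => /negP/negPn/eqP gs.
  rewrite -reduced_rev rev_rcons -val_ucoxV invgM ugenV val_ucoxM.
  by apply: reduced_push_head gs; rewrite reduced_rev; exact: valP.
- have sK x : (x * ugen s * ugen s = x)%g by rewrite -mulgA ugenK mulg1.
  by rewrite invgM ugenV !mulgA sK.
Qed.

Lemma reflectionP (S : finType) (t : ucox S) : reflection (@ugen S) t ->
  exists (g : ucox S) s, reduced (rcons (val g) s) /\ t = (g * ugen s * g^-1)%g.
Proof.
move=> [g [s ->]]; have [h [hs -> _]] := reflection_reduced_rep g s.
by exists h, s.
Qed.

Lemma val_reflection (S : finType) (g : ucox S) s : reduced (rcons (val g) s) ->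
  val (g * ugen s * g^-1)%g = val g ++ s :: rev (val g).
Proof.
move=> gs; rewrite -mulgA !val_ucoxM.
have sg : reduced (s :: rev (val g)) by rewrite -rev_rcons reduced_rev.
by rewrite [X in wmul _ X]push_cons ?wmul_cat// reduced_cat gs.
Qed.

Lemma word_reflectionE (S : finType) (x : seq S) k s0 :
  reduced x -> (k < size x)%N ->
  let g := word_prod (@ugen S) (take k x) in
  reduced (rcons (val g) (nth s0 x k)) /\
  word_reflection (@ugen S) x k = (g * ugen (nth s0 x k) * g^-1)%g.
Proof.
move=> xr kx g.
have tk : reduced (take k.+1 x).
  by move: xr; rewrite -{1}(cat_take_drop k.+1 x) => /cat_sorted2[].
have gE : val g = take k x.
  rewrite val_word_prod_reduced//; move: tk.
  by rewrite (take_nth s0)// -cats1 => /cat_sorted2[].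
have gs : reduced (rcons (val g) (nth s0 x k)) by rewrite gE -take_nth.
split=> //; apply: val_inj; rewrite val_reflection// /word_reflection.
rewrite (take_nth s0)// -gE cat_rcons val_word_prod_reduced//.
by rewrite reduced_cat gs -rev_rcons reduced_rev.
Qed.

(** If s is a left descent of h = g^-1 w, then (g s g^-1) w = g (s h) is
shorter than w = g h; otherwise nothing cancels in g (s h), whose length
exceeds that of w. *)
Lemma inversions_ucox (S : finType) (g w : ucox S) s :
  reduced (rcons (val g) s) ->
  inversions (@ugen S) w (g * ugen s * g^-1)%g <->
  prefix (rcons (val g) s) (val w).
Proof.
move=> gs; have tw : (g * ugen s * g^-1 * w = g * (ugen s * (g^-1 * w)))%g.
  by rewrite !mulgA.
rewrite /inversions [X in X <-> _]/mkset !len_ucox tw.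
suff -> : (size (val (g * (ugen s * (g^-1 * w)))%g) < size (val w))%N =
    prefix (rcons (val g) s) (val w).
  by split=> [[]//|]; split=> //; exists g, s.
rewrite -descent_prefix//; set h := (g^-1 * w)%g; apply/idP/idP => [|hs].
  apply: contraTT => hs; rewrite -leqNgt -{1}(mulVKg g w) -/h.
  have hsr : reduced (s :: val h) by rewrite reduced_cons hs (valP h).
  rewrite (val_ucoxM g (ugen s * h)%g) val_ucoxM [X in wmul _ X]push_cons//.
  rewrite [X in (_ <= size X)%N]wmul_cat ?reduced_cat ?gs// size_cat /=.
  by rewrite addnS ltnW// ltnS size_wmul_le.
have := hs; rewrite descent_prefix// => /prefixP[z wz].
rewrite val_ucoxM (leq_ltn_trans (size_wmul_le _ _))//.
suff -> : size (val w) = (size (val g) + size (val h))%N.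
  by rewrite ltn_add2l size_ugenM.
have zr : reduced (s :: z).
  by have := valP w; rewrite /= wz cat_rcons reduced_cat => /andP[].
rewrite -size_cat -wmul_cat -?val_ucoxM ?mulVKg//.
suff -> : val h = s :: z by rewrite reduced_cat gs.
by rewrite val_ucoxM wz cat_rcons -wmul_cat ?wmulVw// reduced_cat gs.
Qed.

(** * Orderings of acyclic sets *)

(** The position in an ordering decreases strictly along arrows. *)
Lemma ordering_acyclic (S : finType) (Om : rel S) (J : {set S}) u :
  ordering_of Om J u -> acyclic Om J.
Proof.
move=> [_ _ Ju] [//|x p] _ pJ; apply/negP => /= xp.
have : path (fun t s => (index s u < index t u)%N) x (rcons p x).
  apply: (@sub_in_path _ (mem J)) xp; first by move=> t s tJ sJ; apply: Ju.
  apply/allP => y; rewrite /= inE mem_rcons inE orbA orbb => yp.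
  by apply: pJ; rewrite inE.
move=> /order_path_min/=/(_ _)/allP/(_ x).
rewrite mem_rcons mem_head ltnn => h; suff : false by []. apply: h => //.
by move=> a b d /= ab bd; apply: ltn_trans bd ab.
Qed.

Lemma cox_elt_ordering (S : finType) (Om : rel S) (J : {set S}) :
  (exists u, ordering_of Om J u) ->
  exists2 u, ordering_of Om J u &
             cox_elt (@ugen S) Om J = word_prod (@ugen S) u.
Proof.
move=> ex; exists (xget [::] [set u | ordering_of Om J u]) => //.
exact: (@xgetPex _ _ [set u | ordering_of Om J u] ex).
Qed.

Lemma cox_elt_unique (S : finType) (Om : rel S) (J : {set S}) u :
  ordering_of Om J u -> (forall v, ordering_of Om J v -> v = u) ->
  cox_elt (@ugen S) Om J = word_prod (@ugen S) u.
Proof.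
move=> Ju uniqu; have [v Jv ->] := cox_elt_ordering (ex_intro _ u Ju).
by rewrite (uniqu v).
Qed.

Lemma Jmax_unique (S : finType) (Om : rel S) (w : ucox S) (K : {set S}) :
  candidate (@ugen _) Om w K ->
  (forall K', candidate (@ugen _) Om w K' -> K' \subset K) ->
  Jmax (@ugen _) Om w = K.
Proof.
move=> Kw Kmax; apply: xget_unique.
  apply/maxsetP; split; first exact/asboolP.
  move=> B /asboolP/Kmax BK KB; apply/eqP; rewrite finset.eqEsubset.
  by apply/andP.
move=> B /maxsetP[/asboolP Bw Bmax]; apply/esym/Bmax; last exact: Kmax.
exact/asboolP.
Qed.

(** * The reflection representation *)

Lemma coordD (R : realType) (S : finType) (u v : {ffun S -> R^o}) s :
  (u + v) s = u s + v s :> R.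
Proof. exact: ffunE. Qed.

Lemma coordZ (R : realType) (S : finType) (a : R) (v : {ffun S -> R^o}) s :
  (a *: v) s = a * v s :> R.
Proof. exact: ffunE. Qed.

Lemma coordN (R : realType) (S : finType) (v : {ffun S -> R^o}) s :
  (- v) s = - v s :> R.
Proof. exact: ffunE. Qed.

Definition srefl (R : realType) (S : finType) (A : S -> S -> R) (s : S)
    (v : {ffun S -> R^o}) : {ffun S -> R^o} :=
  v - (\sum_t A s t * v t) *: simple_root R s.

Lemma sreflE (R : realType) (S : finType) (A : S -> S -> R) s v t :
  srefl A s v t = v t - (\sum_i A s i * v i) * (t == s)%:R.
Proof. by rewrite /srefl /simple_root !ffunE. Qed.

Lemma srefl_linear (R : realType) (S : finType) (A : S -> S -> R) s :
  linear (srefl A s).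
Proof.
move=> a u v; apply/ffunP => t; 
rewrite sreflE [RHS]coordD [in RHS]coordZ !sreflE (coordD (a *: u)) coordZ.
have -> : \sum_i A s i * (a *: u + v) i =
    a * \sum_i A s i * u i + \sum_i A s i * v i.
  rewrite mulr_sumr -big_split; apply: eq_bigr => i _.
  by rewrite coordD coordZ mulrDr mulrCA.
ring.
Qed.

Definition uact_fun (R : realType) (S : finType) (A : S -> S -> R)
    (w : ucox S) (v : {ffun S -> R^o}) : {ffun S -> R^o} :=
  foldr (srefl A) v (val w).

Lemma uact_linear (R : realType) (S : finType) (A : S -> S -> R) w :
  linear (uact_fun A w).
Proof.
move=> a u v; rewrite /uact_fun; elim: (val w) => //= s x ->.
exact: srefl_linear.
Qed.

HB.instance Definition _ (R : realType) (S : finType) (A : S -> S -> R)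
    (w : ucox S) :=
  GRing.isLinear.Build R {ffun S -> R^o} {ffun S -> R^o} *:%R (uact_fun A w)
    (uact_linear A w).

Definition uact (R : realType) (S : finType) (A : S -> S -> R) (w : ucox S) :
  {linear {ffun S -> R^o} -> {ffun S -> R^o}} := uact_fun A w.

(** Off-diagonal entries at most -2 correspond to a universal Coxeter group
and make the coordinates of roots grow along reduced words. *)
Definition universal_cartan (R : realType) (S : finType) (A : S -> S -> R) :=
  (forall s, A s s = 2) /\ (forall s t, s != t -> A s t <= -2).

Lemma sum_simple_root (R : realType) (S : finType) (A : S -> S -> R) s t :
  \sum_i A s i * simple_root R t i = A s t.
Proof.
rewrite (bigD1 t)//= ffunE eqxx mulr1 big1 ?addr0// => i it.
by rewrite ffunE (negbTE it) mulr0.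
Qed.

Lemma srefl_simple (R : realType) (S : finType) (A : S -> S -> R) s :
  universal_cartan A -> srefl A s (simple_root R s) = - simple_root R s.
Proof.
move=> [A2 _]; rewrite /srefl sum_simple_root A2.
by rewrite scaler_nat mulr2n opprD addrA subrr add0r.
Qed.

Lemma sreflK (R : realType) (S : finType) (A : S -> S -> R) s :
  universal_cartan A -> involutive (srefl A s).
Proof.
move=> [A2 _] v; rewrite {1}/srefl.
have -> : \sum_t A s t * srefl A s v t = - \sum_t A s t * v t.
  set c := \sum_t A s t * v t.
  under eq_bigr do rewrite sreflE -/c mulrBr mulrCA.
  rewrite sumrB -/c -mulr_sumr (bigD1 s)//= eqxx A2 big1 => [|i /negbTE->].
    by rewrite mulr1 addr0; lra.
  by rewrite mulr0.
by rewrite scaleNr opprK /srefl subrK.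
Qed.

Lemma uact_rep (R : realType) (S : finType) (A : S -> S -> R) :
  universal_cartan A -> reflection_rep (@ugen S) A (uact A).
Proof.
move=> UA; split=> // [w x v|s t]; last first.
  by rewrite /uact /= /uact_fun /= /srefl sum_simple_root.
rewrite /uact /= /uact_fun /=; elim: (val w) => //= s u <-.
case: (wmul u (val x)) => //= r y; case: eqP => // ->.
by rewrite sreflK.
Qed.

(** * Positivity of roots *)

Definition dominant (R : realType) (S : finType) (s : S)
    (v : {ffun S -> R^o}) : Prop :=
  [/\ forall t, 0 <= (v t : R), 0 < (v s : R) &
      forall t, t != s -> (v t : R) < v s].

Lemma dominant_simple (R : realType) (S : finType) (s : S) :
  dominant s (simple_root R s).
Proof.
split=> [t||t ts]; rewrite !ffunE ?eqxx ?ler0n ?ltr01//.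
by rewrite (negbTE ts) ltr01.
Qed.

(** The new coordinate at s is at least 2 v_t - v_s, which exceeds v_t since
v_s < v_t; the other coordinates do not change. *)
Lemma dominant_srefl (R : realType) (S : finType) (A : S -> S -> R) s t v :
  universal_cartan A -> s != t -> dominant t v -> dominant s (srefl A s v).
Proof.
move=> [A2 Ale] st [v0 vt vlt].
have vs : v t < srefl A s v s.
  rewrite sreflE eqxx mulr1 (bigD1 s)//= (bigD1 t) 1?eq_sym//= A2.
  have Ast := Ale _ _ st; have vst := vlt _ st.
  set c := \sum_(i | _) _.
  have c0 : c <= 0.
    apply: sumr_le0 => i /andP[si _]; rewrite mulr_le0_ge0//.
    by apply: le_trans (Ale _ _ _) _; rewrite 1?eq_sym//; lra.
  have : A s t * v t <= -2 * v t by rewrite ler_wpM2r.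
  lra.
have vi i : i != s -> srefl A s v i = v i.
  by move=> /negbTE si; rewrite sreflE si mulr0 subr0.
split=> [i||i si].
- have [->|si] := eqVneq i s; first exact: le_trans (v0 t) (ltW vs).
  by rewrite vi.
- exact: lt_trans vt vs.
- rewrite vi//; have [->//|it] := eqVneq i t.
  exact: lt_trans (vlt _ it) vs.
Qed.

Lemma root_dominant (R : realType) (S : finType) (A : S -> S -> R) u s :
  universal_cartan A -> reduced (rcons u s) ->
  dominant (head s u) (foldr (srefl A) (simple_root R s) u).
Proof.
move=> UA; elim: u => [_|r u IH]; first exact: dominant_simple.
rewrite [rcons _ _]/= reduced_cons => /andP[ru usr] /=.
apply: (dominant_srefl (t := head s u)) => //; last exact: IH.
move: ru; case: {IH usr} u => [|t u] /=; rewrite eq_sym.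
  by apply: contra => /eqP->.
by apply: contra => /eqP->.
Qed.

Lemma sreflZ (R : realType) (S : finType) (A : S -> S -> R) s a v :
  srefl A s (a *: v) = a *: srefl A s v.
Proof. exact: (linearZZ (uact A (ugen s))). Qed.

Lemma dominant_inj (R : realType) (S : finType) (s s' : S)
    (v v' : {ffun S -> R^o}) (c : R) :
  dominant s v -> dominant s' v' -> 0 <= c -> v = c *: v' -> s = s'.
Proof.
move=> [_ _ vlt] [_ _ vlt'] c0 vE; apply/eqP/negPn/negP => ss.
have := vlt s'; rewrite eq_sym => /(_ ss); apply/negP; rewrite -leNgt.
by rewrite vE !coordZ ler_wpM2l// ltW// vlt'.
Qed.

(** The first letter of the word is where the largest coordinate lies, so
proportional roots have words with the same first letter; cancel its
reflection and continue. If only one of the words is exhausted, a positive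
root would be a nonpositive multiple of a positive root. *)
Lemma root_word_inj (R : realType) (S : finType) (A : S -> S -> R) u s u' s'
    (c : R) :
  universal_cartan A -> reduced (rcons u s) -> reduced (rcons u' s') ->
  0 <= c ->
  foldr (srefl A) (simple_root R s) u =
    c *: foldr (srefl A) (simple_root R s') u' ->
  u = u' /\ s = s'.
Proof.
move=> UA + + c0; elim: u u' => [|r u IH] [|r' u'] us us' vE;
  have := dominant_inj (root_dominant UA us) (root_dominant UA us') c0 vE;
  rewrite /= => sE; subst => //.
- have [v0 _ _] := root_dominant UA (reduced_tail us').
  move/(congr1 (srefl A r')): vE.
  rewrite /= srefl_simple// [RHS]sreflZ.
  rewrite sreflK// => /ffunP/(_ r'); rewrite coordN coordZ ffunE eqxx => vE.
  by have := mulr_ge0 c0 (v0 r'); rewrite -vE oppr_ge0 ler10.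
- have [v0 _ _] := root_dominant UA (reduced_tail us).
  move/(congr1 (srefl A s')): vE.
  rewrite /= sreflK// [RHS]sreflZ.
  rewrite srefl_simple// => vE.
  have [_ vh _] := root_dominant UA (reduced_tail us).
  move: vE => /ffunP/(_ (head s u)); rewrite coordZ coordN ffunE => vE.
  have := mulr_ge0 c0 (ler0n R (head s u == s')).
  by move: vh; rewrite vE mulrN oppr_gt0 => /lt_le_trans h /h; rewrite ltxx.
- have [|-> -> //] := IH u' (reduced_tail us) (reduced_tail us').
  move/(congr1 (srefl A r')): vE.
  rewrite /= sreflK// [RHS]sreflZ.
  by rewrite sreflK.
Qed.

Definition nonneg (R : realType) (S : finType) (v : {ffun S -> R^o}) : Prop :=
  forall s, 0 <= (v s : R).

Lemma uact_pos (R : realType) (S : finType) (A : S -> S -> R) (g : ucox S) s :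
  universal_cartan A -> reduced (rcons (val g) s) ->
  nonneg (uact A g (simple_root R s)).
Proof. by move=> UA /(root_dominant UA)[]. Qed.

Lemma uact_ugen (R : realType) (S : finType) (A : S -> S -> R) (g : ucox S) s :
  universal_cartan A ->
  uact A (g * ugen s)%g (simple_root R s) = - uact A g (simple_root R s).
Proof.
move=> UA; have [_ actM _] := uact_rep UA.
by rewrite actM -[uact A (ugen s) _]/(srefl A s _) srefl_simple// linearN.
Qed.

Lemma uact_inj (R : realType) (S : finType) (A : S -> S -> R) (g : ucox S) :
  universal_cartan A -> injective (uact A g).
Proof.
move=> UA; have [act1 actM _] := uact_rep UA.
by apply: (@can_inj _ _ _ (uact A g^-1%g)) => v; rewrite -actM mulVg act1.
Qed.

Lemma uact_simple_neq0 (R : realType) (S : finType) (A : S -> S -> R)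
    (g : ucox S) s :
  universal_cartan A -> uact A g (simple_root R s) <> 0.
Proof.
move=> UA; rewrite -(linear0 (uact A g)) => /(uact_inj UA)/ffunP/(_ s).
by rewrite !ffunE eqxx => /eqP; rewrite oner_eq0.
Qed.

Lemma nonneg_anti (R : realType) (S : finType) (v : {ffun S -> R^o}) :
  nonneg v -> nonneg (- v) -> v = 0.
Proof.
move=> v0 Nv0; apply/ffunP => s; rewrite [RHS]ffunE; apply/eqP.
by rewrite eq_le v0 andbT -oppr_ge0 -coordN.
Qed.

(** * Reflections and positive roots *)

(** The normal form of a reflection is a palindrome u s u^-1, so k is the
position of the middle letter s. The value 0 is taken only at the identity. *)
Definition ubeta (R : realType) (S : finType) (A : S -> S -> R)
    (t : ucox S) : {ffun S -> R^o} :=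
  let k := (size (val t))./2 in
  if drop k (val t) is s :: _
  then foldr (srefl A) (simple_root R s) (take k (val t)) else 0.

Lemma ubetaE (R : realType) (S : finType) (A : S -> S -> R) (g : ucox S) s :
  reduced (rcons (val g) s) ->
  ubeta A (g * ugen s * g^-1)%g = uact A g (simple_root R s).
Proof.
move=> gs; rewrite /ubeta val_reflection// size_cat /= size_rev addnS addnn.
by rewrite -add1n (half_bit_double _ true) drop_size_cat// take_size_cat.
Qed.

Lemma root_scale_inj (R : realType) (S : finType) (A : S -> S -> R)
    (r s : ucox S) (c : R) :
  universal_cartan A ->
  reflection (@ugen S) r -> reflection (@ugen S) s ->
  0 <= c -> ubeta A s = c *: ubeta A r -> s = r.
Proof.
move=> UA /reflectionP[g [a [ga ->]]] /reflectionP[h [b [hb ->]]] c0.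
rewrite !ubetaE// => E.
by have [/val_inj-> ->] := root_word_inj UA hb ga c0 E.
Qed.

Lemma ubeta_labelling (R : realType) (S : finType) (A : S -> S -> R) :
  universal_cartan A -> root_labelling (@ugen S) (uact A) (ubeta A).
Proof.
move=> UA; split; first split.
- move=> _ /reflectionP[g [s [gs ->]]]; rewrite ubetaE//.
  by split; [exists g, s | exact: uact_pos].
- move=> t t' /set_mem/reflectionP[g [s [gs ->]]].
  move=> /set_mem/reflectionP[h [r [hr ->]]]; rewrite !ubetaE// => gh.
  have [] := @root_word_inj _ _ A _ _ _ _ 1 UA gs hr ler01.
    by rewrite scale1r.
  by move=> /val_inj-> ->.
- move=> _ [[g [s ->]] gs0]; have [h [hs gh]] := reflection_reduced_rep g s.
  case=> E; subst g; exists (h * ugen s * h^-1)%g.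
  + by exists h, s.
  + exact: ubetaE.
  + by exists h, s.
  + move: gs0; rewrite uact_ugen// => gs0.
    case: (uact_simple_neq0 (g := h) (s := s) UA).
    by apply: nonneg_anti => //; exact: uact_pos.
- move=> s; have := @ubetaE R S A 1%g s isT.
  by rewrite mul1g invg1 mulg1.
- move=> g s; have [h [hs gh]] := reflection_reduced_rep g s.
  rewrite gh ubetaE//; case=> ->; first by left.
  by right; exact: uact_ugen.
Qed.

(** * Inversion sets are biconvex *)

(** With t = g s g^-1, the root w^-1 beta_t is h^-1 alpha_s for h = g^-1 w,
and its sign tells whether s is a left descent of h. *)
Lemma inversion_sign (R : realType) (S : finType) (A : S -> S -> R)
    (w t : ucox S) :
  universal_cartan A -> reflection (@ugen S) t ->
  (inversions (@ugen S) w t -> nonneg (- uact A w^-1%g (ubeta A t))) /\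
  (~ inversions (@ugen S) w t -> nonneg (uact A w^-1%g (ubeta A t))).
Proof.
move=> UA /reflectionP[g [s [gs ->]]]; rewrite ubetaE//.
have [_ actM _] := uact_rep UA; rewrite -actM.
rewrite inversions_ucox// -descent_prefix//.
have hE : (w^-1 * g = (g^-1 * w)^-1)%g by rewrite invgM invgK.
rewrite hE; move: (g^-1 * w)%g => h {hE}; split=> [hs|/negP hs].
- suff -> : (h^-1 = (ugen s * h)^-1 * ugen s)%g.
    rewrite uact_ugen// opprK; apply: uact_pos => //.
    rewrite val_ucoxV -rev_cons reduced_rev val_ucoxM.
    by apply: reduced_push_head (eqP hs); exact: valP.
  by rewrite invgM ugenV -mulgA ugenK mulg1.
- apply: uact_pos => //.
  by rewrite val_ucoxV -rev_cons reduced_rev reduced_cons hs (valP h).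
Qed.

(** The inversions of w are the reflections whose root is made negative by
w^-1, a linear map; both halves follow, since no root is zero. *)
Lemma inversions_biconvex (R : realType) (S : finType) (A : S -> S -> R)
    (w r s t : ucox S) :
  universal_cartan A ->
  reflection (@ugen S) r -> reflection (@ugen S) s -> reflection (@ugen S) t ->
  in_positive_span (ubeta A s) (ubeta A r) (ubeta A t) ->
  let inv := inversions (@ugen S) w in
  (inv r -> inv t -> inv s) /\ (~ inv r -> ~ inv t -> ~ inv s).
Proof.
move=> UA Rr Rs Rt [c [d [c0 d0 sE]]] inv.
have [pr nr] := inversion_sign w UA Rr; have [pt nt] := inversion_sign w UA Rt.
have [ps ns] := inversion_sign w UA Rs.
have sE' : uact A w^-1%g (ubeta A s) =
    c *: uact A w^-1%g (ubeta A r) + d *: uact A w^-1%g (ubeta A t).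
  by rewrite sE linearD !linearZ.
have s0 : uact A w^-1%g (ubeta A s) <> 0.
  have [g [a [ga ->]]] := reflectionP Rs.
  have [_ actM _] := uact_rep UA.
  by rewrite ubetaE// -actM; exact: uact_simple_neq0.
split=> [ir it|ir it sw].
- apply: contrapT => /ns spos; apply/s0/nonneg_anti => // i.
  rewrite sE' opprD -!scalerN coordD !coordZ.
  by rewrite addr_ge0// mulr_ge0//; [exact: pr | exact: pt].
- apply/s0/nonneg_anti; last exact: ps.
  move=> i; rewrite sE' coordD !coordZ.
  by rewrite addr_ge0// mulr_ge0//; [exact: nr | exact: nt].
Qed.

(** Given biconvexity, the only further pattern to exclude is that s and t are
distinct members while r is not one. *)
Lemma triple_meet (T : Type) (P : set T) (r s t : T) :
  (P r -> P t -> P s) -> (~ P r -> ~ P t -> ~ P s) ->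
  (P s -> P t -> s <> t -> P r) ->
  let I := P `&` [set r; s; t] in
  I = set0 \/ I = [set r] \/ I = [set r; s] \/ I = [set r; s; t] \/
  I = [set t].
Proof.
move=> rt_s Nrt_s st_r I.
have [Pr|Pr] := pselect (P r); have [Pt|Pt] := pselect (P t).
- do 3 right; left; apply/seteqP; split=> x /=; first by case.
  by move=> [[->|->]|->]; split; rewrite /=; auto.
- have [Ps|Ps] := pselect (P s).
    do 2 right; left; apply/seteqP; split=> x /=.
      by move=> [Px [[->|->]|xt]]; [left|right|rewrite xt in Px].
    by move=> [->|->]; split; rewrite /=; auto.
  right; left; apply/seteqP; split=> x /=;
    last by move=> ->; split; rewrite /=; auto.
  by move=> [Px [[->//|xs]|xt]]; [rewrite xs in Px | rewrite xt in Px].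
- do 4 right; apply/seteqP; split=> x /=;
    last by move=> ->; split; rewrite /=; auto.
  move=> [Px [[xr|xs]|->//]]; first by rewrite xr in Px.
  by rewrite xs in Px *; apply: contrapT => st; exact: Pr (st_r Px Pt st).
- left; apply/seteqP; split=> x //= [Px [[xr|xs]|xt]].
  + by rewrite xr in Px.
  + by rewrite xs in Px; exact: Nrt_s Pr Pt Px.
  + by rewrite xt in Px.
Qed.

(** * The rank three example *)

Definition i0 : 'I_3 := @Ordinal 3 0 isT.

Definition i1 : 'I_3 := @Ordinal 3 1 isT.

Definition i2 : 'I_3 := @Ordinal 3 2 isT.

Lemma ord3P (P : 'I_3 -> Prop) : P i0 -> P i1 -> P i2 -> forall i, P i.
Proof.
move=> P0 P1 P2 [[|[|[|//]]] h];
  [suff -> : Ordinal h = i0 by []|suff -> : Ordinal h = i1 by []|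
   suff -> : Ordinal h = i2 by []]; exact: val_inj.
Qed.

(** The entry -9 on the pair {1, 2} and -2 on the two others: the values b = 9
and a = e = 2 satisfy b - 2 a e > 0. *)
Definition cartan3 (R : realType) (s t : 'I_3) : R :=
  if s == t then 2 else if (0 < s)%N && (0 < t)%N then -9 else -2.

(** The arrows 1 -> 0, 2 -> 1 and 0 -> 2. *)
Definition Om3 : rel 'I_3 := fun s t => s == (t.+1 %% 3)%N :> nat.

Definition w3 : ucox 'I_3 := exist _ [:: i0; i1; i2] isT.

Lemma cartan3_universal (R : realType) : universal_cartan (@cartan3 R).
Proof.
split=> [s|s t]; first by rewrite /cartan3 eqxx.
by rewrite /cartan3 => /negbTE->; case: ifP => _; lra.
Qed.

Lemma cartan3_sym (R : realType) s t : cartan3 R s t = cartan3 R t s.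
Proof. by rewrite /cartan3 eq_sym andbC. Qed.

Lemma cartan3_cartan (R : realType) :
  cartan_matrix (@ugen 'I_3) (@uord 'I_3) (@cartan3 R) (fun=> 1).
Proof.
have [A2 Ale] := cartan3_universal R; split=> //.
- by move=> s t /Ale; lra.
- by move=> s t st; rewrite /uord (negbTE st).
- by move=> s t /Ale; rewrite (cartan3_sym R t) => h _; nra.
- by move=> s t; rewrite cartan3_sym.
- by move=> s t; rewrite cartan3_sym.
Qed.

Lemma Om3_orientation : orientation (@ugen 'I_3) Om3.
Proof.
have gg (s t : 'I_3) : diagram (@ugen _) s t = (s != t).
  rewrite /diagram; case: eqVneq => //= st; apply/eqP => /(congr1 val).
  rewrite !val_ucoxM /= (negbTE st) eq_sym (negbTE st) => -[/eqP].
  by rewrite (negbTE st).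
by split=> s t; rewrite ?gg; move: s t; do 2 apply: ord3P.
Qed.

Lemma sum_ord3 (R : nmodType) (F : 'I_3 -> R) :
  \sum_i F i = F i0 + F i1 + F i2.
Proof.
rewrite !big_ord_recl big_ord0 addr0 addrA.
by congr (F _ + F _ + F _); exact: val_inj.
Qed.

Lemma omega3E (R : realType) (x y : {ffun 'I_3 -> R^o}) :
  omega (@cartan3 R) (fun=> 1) Om3 x y =
    2 * (x i0 * y i1 - x i1 * y i0) + 9 * (x i1 * y i2 - x i2 * y i1)
      + 2 * (x i2 * y i0 - x i0 * y i2) :> R.
Proof.
rewrite /omega !sum_ord3 /omega_coef /cartan3 /Om3 /= .
move: (x i0 : R) (x i1 : R) (x i2 : R) (y i0 : R) (y i1 : R) (y i2 : R).
move=> x0 x1 x2 y0 y1 y2; ring.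
Qed.

(** The root of the inversion of [w3] attached to its prefix of length k + 1. *)
Definition root3 (R : realType) (k : nat) : {ffun 'I_3 -> R^o} :=
  foldr (srefl (@cartan3 R)) (simple_root R (nth i0 (val w3) k))
    (take k (val w3)).

Lemma root3E (R : realType) (k : 'I_3) :
  [/\ root3 R k i0 = nth 0 [:: 1; 2; 20] k :> R,
      root3 R k i1 = nth 0 [:: 0; 1; 9] k :> R &
      root3 R k i2 = nth 0 [:: 0; 0; 1] k :> R].
Proof.
have sE s v t : srefl (@cartan3 R) s v t =
    v t - (cartan3 R s i0 * v i0 + cartan3 R s i1 * v i1 +
           cartan3 R s i2 * v i2) * (t == s)%:R :> R.
  by rewrite sreflE sum_ord3.
move: k; apply: ord3P; rewrite /root3 /= ?sE /cartan3 /= !ffunE /=; split; ring.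
Qed.

Lemma omega3_root (R : realType) (i j : 'I_3) : (i < j)%N ->
  0 < omega (@cartan3 R) (fun=> 1) Om3 (root3 R i) (root3 R j).
Proof.
rewrite omega3E; have [-> -> ->] := root3E R i; have [-> -> ->] := root3E R j.
by move: i j; do 2 apply: ord3P => //=; move=> _; lra.
Qed.

Lemma ubeta_word_reflection (R : realType) k : (k < 3)%N ->
  ubeta (@cartan3 R) (word_reflection (@ugen 'I_3) (val w3) k) = root3 R k.
Proof.
move=> k3; have [gs ->] := word_reflectionE i0 (valP w3) k3.
rewrite ubetaE// /uact /= /uact_fun val_word_prod_reduced//.
by move: k k3 {gs} => [|[|[|]]].
Qed.

Lemma inversion_w3 (R : realType) t :
  inversions (@ugen _) w3 t ->
  exists k : 'I_3, ubeta (@cartan3 R) t = root3 R k.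
Proof.
move=> tw; have [Rt _] := tw; have [g [s [gs tE]]] := reflectionP Rt.
move: tw; rewrite tE inversions_ucox// => gp.
have k3 : (size (val g) < 3)%N by have := size_prefix gp; rewrite size_rcons.
exists (Ordinal k3); rewrite ubetaE// /root3 /= /uact /= /uact_fun.
move: gp; rewrite prefixE size_rcons (take_nth i0)// => /eqP/rcons_inj[gE sE].
by rewrite gE sE.
Qed.

(** When t follows s in the inversion order, the root of s has coordinate 0
where that of t has 1, so the root of s is a multiple of that of r. When t
precedes s, omega(beta_s, beta_t) would be both negative and nonnegative. *)
Lemma aligned3 (R : realType) r s t :
  reflection (@ugen 'I_3) r -> reflection (@ugen _) s ->
  reflection (@ugen _) t ->
  in_positive_span (ubeta (@cartan3 R) s) (ubeta (@cartan3 R) r)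
    (ubeta (@cartan3 R) t) ->
  0 <= omega (@cartan3 R) (fun=> 1) Om3 (ubeta (@cartan3 R) r)
         (ubeta (@cartan3 R) t) ->
  inversions (@ugen _) w3 s -> inversions (@ugen _) w3 t -> s <> t ->
  inversions (@ugen _) w3 r.
Proof.
move=> Rr Rs Rt [c [d [c0 d0 sE]]] rt0 sw tw st.
have UA := cartan3_universal R.
have [i iE] := inversion_w3 R sw; have [j jE] := inversion_w3 R tw.
case: (ltngtP i j) => ij.
- have dE : d = 0.
    have bt0 : 0 <= c * ubeta (@cartan3 R) r j.
      have [g [a [ga ->]]] := reflectionP Rr.
      by rewrite mulr_ge0// ubetaE//; exact: uact_pos.
    move: sE => /ffunP/(_ j); rewrite coordD !coordZ iE jE.
    have : root3 R i j = 0 /\ root3 R j j = 1.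
      have [Ei0 Ei1 Ei2] := root3E R i; have [Ej0 Ej1 Ej2] := root3E R j.
      move: i j ij {iE jE bt0} Ei0 Ei1 Ei2 Ej0 Ej1 Ej2.
      by do 2 apply: ord3P => //=.
    move=> [-> ->]; lra.
  by rewrite -(root_scale_inj UA Rr Rs c0)// sE dE scale0r addr0.
- have := omega3_root R ij; rewrite -iE -jE sE; move: rt0.
  rewrite !omega3E !coordD !coordZ.
  set b := ubeta _ r; set b' := ubeta _ t => rt0 h; exfalso.
  have := mulr_ge0 c0 rt0; lra.
- case: st; apply: (root_scale_inj UA Rt Rs ler01).
  by rewrite scale1r iE jE (val_inj ij).
Qed.

(** * The element is not sortable *)

Lemma acyclic3_missing (K : {set 'I_3}) : acyclic Om3 K -> exists z, z \notin K.
Proof.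
(* The full set carries the directed cycle 0 -> 2 -> 1 -> 0. *)
move=> /(_ [:: i0; i2; i1] isT) Kac; apply: contrapT => nK.
have KT x : x \in K by apply: contrapT => /negP xK; apply: nK; exists x.
by have := Kac (fun x _ => KT x).
Qed.

(** If z is missing from K, the two letters after z in cyclic order are in
admissible order. *)
Lemma acyclic3_ordering (K : {set 'I_3}) :
  acyclic Om3 K -> exists u, ordering_of Om3 K u.
Proof.
move=> /acyclic3_missing[z zK].
pose zs := nth [::] [:: [:: i1; i2]; [:: i2; i0]; [:: i0; i1]] z.
exists [seq x <- zs | x \in K]; split.
- by rewrite filter_uniq//; move: z @zs {zK}; apply: ord3P.
- move=> x; rewrite mem_filter /=; apply: andb_idr => xK.
  have : x != z by apply: contraNneq zK => <-.
  by move: x z @zs {zK xK}; do 2 apply: ord3P.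
- move=> s t sK tK.
  have : s != z by apply: contraNneq zK => <-.
  have : t != z by apply: contraNneq zK => <-.
  move: s t z @zs {zK} sK tK.
  by do 3 apply: ord3P => //=; move=> sK tK; rewrite sK tK.
Qed.

Lemma candidate3 (w : ucox 'I_3) (K : {set 'I_3}) :
  candidate (@ugen _) Om3 w K ->
  exists u, [/\ uniq u, u =i K & prefix u (val w)].
Proof.
move=> [Kac]; have [u [uu uK _] ->] := cox_elt_ordering (acyclic3_ordering Kac).
rewrite weak_le_ucox val_word_prod_reduced ?uniq_reduced// => up.
by exists u.
Qed.

Lemma ordering01_unique u :
  ordering_of Om3 [set i0; i1]%SET u -> u = [:: i0; i1].
Proof.
move=> [uu uK uo].
have : perm_eq u [:: i0; i1].
  by apply: uniq_perm => // x; rewrite uK !inE.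
case: u {uu} uK uo => [|a [|b [|c u]]] uK uo /[dup] /perm_size //= _.
move: a b uK uo; do 2 apply: ord3P => //; move=> uK uo.
by have := uo i0 i1; rewrite !inE => /(_ isT isT isT).
Qed.

Lemma ordering01 : ordering_of Om3 [set i0; i1]%SET [:: i0; i1].
Proof.
split=> //; first by move=> x; rewrite !inE.
by move=> s t; rewrite !inE => /orP[]/eqP-> /orP[]/eqP->.
Qed.

Lemma cox_elt01 :
  cox_elt (@ugen _) Om3 [set i0; i1]%SET = word_prod (@ugen _) [:: i0; i1].
Proof. exact: cox_elt_unique ordering01 ordering01_unique. Qed.

Lemma ordering2 : ordering_of Om3 [set i2]%SET [:: i2].
Proof.
split=> //; first by move=> x; rewrite !inE.
by move=> s t; rewrite !inE => /eqP-> /eqP->.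
Qed.

Lemma cox_elt2 :
  cox_elt (@ugen _) Om3 [set i2]%SET = word_prod (@ugen _) [:: i2].
Proof.
apply: cox_elt_unique ordering2 _ => u [uu uK _].
apply: perm_small_eq => //; apply: uniq_perm => // x.
by rewrite uK !inE.
Qed.

(** The full set is not acyclic, so the largest candidate for 012 is {0, 1};
the remainder is the generator 2, whose largest candidate {2} is not contained
in {0, 1}. *)
Lemma w3_not_sortable : ~ sortable (@ugen _) Om3 w3.
Proof.
have J1 : Jmax (@ugen _) Om3 w3 = [set i0; i1]%SET.
  apply: Jmax_unique; first split.
  - exact: ordering_acyclic ordering01.
  - by rewrite weak_le_ucox cox_elt01 val_word_prod_reduced.
  - move=> K /[dup] /candidate3[u [_ uK up]] [/acyclic3_missing[z zK] _].
    have zi2 : prefix u [:: i0; i1].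
      move: up zK; rewrite -uK; case: u {uK} => [|a [|b [|c u]]] //=.
      move=> /and4P[/eqP-> /eqP-> /eqP-> _].
      by move: z; apply: ord3P; rewrite !inE.
    apply/fintype.subsetP => x; rewrite -uK => xu.
    by have := mem_infix (prefixW zi2) xu; rewrite !inE.
have J2 : Jmax (@ugen _) Om3 (ugen i2) = [set i2]%SET.
  apply: Jmax_unique; first split.
  - exact: ordering_acyclic ordering2.
  - by rewrite weak_le_ucox cox_elt2 val_word_prod_reduced.
  - move=> K /candidate3[u [_ uK up]].
    apply/fintype.subsetP => x; rewrite -uK => xu.
    by have := mem_infix (prefixW up) xu; rewrite !inE.
move=> /(_ 0%N); rewrite /= J1 cox_elt01.
have -> : ((word_prod (@ugen _) [:: i0; i1])^-1 * w3 = ugen i2)%g.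
  by apply: val_inj; rewrite val_ucoxM val_ucoxV val_word_prod_reduced.
by rewrite J2 => /fintype.subsetP/(_ i2); rewrite !inE => /(_ isT).
Qed.

Theorem mainTheorem10 (R : realType) :
  exists (W : groupType) (S : finType) (gen : S -> W) (m : S -> S -> nat)
    (A : S -> S -> R) (delta : S -> R)
    (act : W -> {linear {ffun S -> R^o} -> {ffun S -> R^o}})
    (beta : W -> {ffun S -> R^o})
    (Om : rel S) (w : W) (a : seq S),
    [/\ coxeter_system gen m, cartan_matrix gen m A delta,
        reflection_rep gen A act & root_labelling gen act beta] /\
    orientation gen Om /\
    reduced_word gen w a /\
    ~ sortable gen Om w /\
    (forall i j : nat, (i < j)%N -> (j < size a)%N ->
       let ti := word_reflection gen a i in
       let tj := word_reflection gen a j in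
       0 <= omega A delta Om (beta ti) (beta tj) /\
       ((ti * tj)%g <> (tj * ti)%g ->
        0 < omega A delta Om (beta ti) (beta tj))) /\
    (forall r s t : W,
       reflection gen r -> reflection gen s -> reflection gen t ->
       in_positive_span (beta s) (beta r) (beta t) ->
       0 <= omega A delta Om (beta r) (beta t) ->
       let I := inversions gen w `&` [set r; s; t] in
       I = set0 \/ I = [set r] \/ I = [set r; s] \/ I = [set r; s; t] \/
       I = [set t]).
Proof.
have UA := cartan3_universal R.
exists (ucox 'I_3), 'I_3, (@ugen _), (@uord _), (@cartan3 R), (fun=> 1).
exists (uact (@cartan3 R)), (ubeta (@cartan3 R)), Om3, w3, (val w3).
split.
  split; [exact: ucox_system | exact: cartan3_cartan | exact: uact_rep |].
  exact: ubeta_labelling.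
split; first exact: Om3_orientation.
split; first exact: reduced_word_val.
split; first exact: w3_not_sortable.
split.
  move=> i j ij j3; have i3 := ltn_trans ij j3.
  rewrite /= !ubeta_word_reflection//.
  have h := @omega3_root R (Ordinal i3) (Ordinal j3) ij.
  by split=> //; exact: ltW.
move=> r s t Rr Rs Rt rst rt0.
have [inv_s Ninv_s] := inversions_biconvex w3 UA Rr Rs Rt rst.
apply: triple_meet inv_s Ninv_s _; exact: aligned3 Rr Rs Rt rst rt0.
Qed.
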